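(* Let $E$ be a finite directed graph and fix $\lambda\in\mathbb{R}$. Let $\delta:C^0\to C^1$ be the coboundary map dual to the boundary map $\partial:C_1\to C_0$ of the chain complex of $E$ with parameter $\lambda$. Then the elements of the subspace $Z^0=\ker(\delta)\leq C^0$ are precisely the special generalized graph weights on $E$ with parameter $\lambda$.
   Context: $E=(E^0,E^1,s,r)$ is a finite directed graph with source and range maps $s,r$. For $v\in E^0$ let $B_v=\{e\in E^1: s(e)=v\}$ (the edge bundle at $v$); $v$ is a sink if $B_v=\emptyset$. A generalized graph weight on $E$ is a pair of real-valued functions $(g,\lambda)$ on $E^0$ and $E^1$ with $g(v)=\sum_{e\in B_v}\lambda(e)g(r(e))$ for every $v\in E^0$ that is not a sink; it is special if $\lambda$ is constant, and then the constant $\lambda$ is its parameter; for fixed parameter it is identified with the function $g:E^0\to\mathbb{R}$, i.e. with an element of $C^0$. Chain complex: $0\to C_1\xrightarrow{\partial}C_0\to0$, where $C_0=\bigoplus_{v\in E^0}\mathbb{R}v$ has the vertices as basis, $C_1=\bigoplus_{v\in E^0}\mathbb{R}B_v$ has as basis one formal symbol $B_v$ for each vertex $v$ (including sinks), and $\partial(B_v)=0$ if $v$ is a sink, $\partial(B_v)=\lambda\sum_{e\in B_v}r(e)-v$ otherwise. The dual cochain complex is $0\leftarrow C^1\xleftarrow{\delta}C^0\leftarrow0$, with $C^i=\mathrm{Hom}(C_i,\mathbb{R})$ and $\delta g=g\circ\partial$. *)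

(* Defs.v *)
From HB Require Import structures.
From mathcomp Require Import all_boot all_order all_algebra reals.

Set Implicit Arguments.
Unset Strict Implicit.
Unset Printing Implicit Defensive.

Import GRing.Theory.
Local Open Scope ring_scope.

(* Finite directed graphs; loops and parallel edges are allowed. *)
Record digraph := Digraph {
  vertex : finType;
  edge : finType;
  source : edge -> vertex;
  range : edge -> vertex
}.

Definition bundle (E : digraph) (v : vertex E) : {set edge E} :=
  [set e | source e == v].

Definition sink (E : digraph) (v : vertex E) : bool := bundle v == set0.

Section Weights.
Variables (R : realType) (E : digraph).

Definition generalized_weight (g : vertex E -> R) (l : edge E -> R) : Prop :=
  forall v, ~~ sink v -> g v = \sum_(e in bundle v) l e * g (range e).

Definition special_weight (lam : R) (g : vertex E -> R) : Prop :=
  generalized_weight g (fun=> lam).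

End Weights.

Section Chains.
Variables (R : realType) (E : digraph).

Definition chain0 : vectType R := {ffun vertex E -> R^o}.

(* The basis of C_1 is the family of formal symbols B_v, one for every vertex
   (hence a separate one for each sink, although B_v is then empty), so chains
   in C_1 are also indexed by vertices. *)
Definition chain1 : vectType R := {ffun vertex E -> R^o}.

Definition vertex_chain (v : vertex E) : chain0 :=
  [ffun w => (w == v)%:R : R^o].

Definition bundle_chain (v : vertex E) : chain1 :=
  [ffun w => (w == v)%:R : R^o].

Definition boundary_gen (lam : R) (v : vertex E) : chain0 :=
  if sink v then 0
  else lam *: (\sum_(e in bundle v) vertex_chain (range e)) - vertex_chain v.

Definition boundary_fun (lam : R) (c : chain1) : chain0 :=
  \sum_v (c : {ffun vertex E -> R^o}) v *: boundary_gen lam v.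

Lemma boundary_fun_linear lam : linear (boundary_fun lam).
Proof.
move=> a c d; rewrite /boundary_fun scaler_sumr -big_split /=.
by apply: eq_bigr => v _; rewrite !ffunE scalerDl scalerA.
Qed.

HB.instance Definition _ lam :=
  GRing.isLinear.Build R chain1 chain0 *:%R (boundary_fun lam)
    (boundary_fun_linear lam).

Definition boundary (lam : R) : 'Hom(chain1, chain0) :=
  linfun (boundary_fun lam).

Lemma boundary_bundle lam v :
  boundary lam (bundle_chain v) = boundary_gen lam v.
Proof.
rewrite /boundary lfunE /= /boundary_fun (bigD1 v) //= ffunE eqxx scale1r.
by rewrite big1 ?addr0 // => w /negbTE nwv; rewrite ffunE nwv scale0r.
Qed.

Definition cochain0 : vectType R := 'Hom(chain0, R^o).
Definition cochain1 : vectType R := 'Hom(chain1, R^o).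

Definition coboundary_fun (lam : R) (g : cochain0) : cochain1 :=
  ((g : 'Hom(chain0, R^o)) \o boundary lam)%VF.

Lemma coboundary_fun_linear lam : linear (coboundary_fun lam).
Proof. by move=> a g h; rewrite /coboundary_fun comp_lfunDl comp_lfunZl. Qed.

HB.instance Definition _ lam :=
  GRing.isLinear.Build R cochain0 cochain1 *:%R (coboundary_fun lam)
    (coboundary_fun_linear lam).

Definition coboundary (lam : R) : 'Hom(cochain0, cochain1) :=
  linfun (coboundary_fun lam).

Lemma coboundaryE lam (g : 'Hom(chain0, R^o)) :
  coboundary lam g = (g \o boundary lam)%VF.
Proof. by rewrite /coboundary lfunE. Qed.

Definition Z0 (lam : R) : {vspace cochain0} := lker (coboundary lam).

(* The identification of C^0 = Hom(C_0, R) with functions on the vertices: a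
   cochain is determined by its (arbitrary) values on the basis of vertices. *)
Definition vertex_values (g : cochain0) : {ffun vertex E -> R} :=
  [ffun v => (g : 'Hom(chain0, R^o)) (vertex_chain v)].

Definition extend_fun (w : {ffun vertex E -> R}) (c : chain0) : R^o :=
  \sum_v (c : {ffun vertex E -> R^o}) v *: (w v : R^o).

Lemma extend_fun_linear w : linear (extend_fun w).
Proof.
move=> a c d; rewrite /extend_fun scaler_sumr -big_split /=.
by apply: eq_bigr => v _; rewrite !ffunE scalerDl scalerA.
Qed.

HB.instance Definition _ w :=
  GRing.isLinear.Build R chain0 R^o *:%R (extend_fun w) (extend_fun_linear w).

Lemma vertex_values_bij : bijective vertex_values.
Proof.
exists (fun w => linfun (extend_fun w)) => [g|w].
  apply/lfunP => c; rewrite lfunE /= /extend_fun.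
  have {2}-> : c = \sum_v (c : {ffun vertex E -> R^o}) v *: vertex_chain v.
    apply/ffunP => u; rewrite sum_ffunE (bigD1 u) //= !ffunE eqxx.
    rewrite big1 => [|w /negbTE nwu].
      by rewrite addr0 /GRing.scale /= mulr1.
    by rewrite !ffunE eq_sym nwu scaler0.
  by rewrite linear_sum; apply: eq_bigr => v _; rewrite ffunE linearZ.
apply/ffunP => v; rewrite ffunE lfunE /= /extend_fun (bigD1 v) //= ffunE eqxx.
by rewrite scale1r big1 ?addr0 // => u /negbTE nuv; rewrite ffunE nuv scale0r.
Qed.

End Chains.

Arguments boundary {R} E lam.
Arguments coboundary {R} E lam.
Arguments Z0 {R} E lam.

(* Main.v *)
(* A linear form on C_1 vanishes iff it vanishes on the basis symbols B_v. For
   delta g, its value on B_v is 0 when v is a sink, and otherwise it is the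
   defect lambda * sum_(e in B_v) g(r(e)) - g(v) of the weight equation at v. *)
Require Import Defs.
From mathcomp Require Import all_boot all_order all_algebra reals.

Import GRing.Theory.
Local Open Scope ring_scope.

Lemma coboundary_bundle (R : realType) (E : digraph) (lam : R)
    (g : cochain0 R E) (v : vertex E) :
  (coboundary E lam g : 'Hom(chain1 R E, R^o)) (bundle_chain R v) =
  if sink v then 0
  else \sum_(e in bundle v) lam * vertex_values g (range e)
       - vertex_values g v.
Proof.
rewrite coboundaryE comp_lfunE boundary_bundle /boundary_gen.
case: ifP => _; first by rewrite linear0.
(* Scaling in [R^o] is multiplication, so once [lam] is factored out on the right both sides have
   the shape [lam * _ - _] up to conversion. *)
rewrite linearB linearZ linear_sum -mulr_sumr ffunE.
by congr (lam * _ - _); apply: eq_bigr => e _; rewrite ffunE.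
Qed.

(** Spanning by the symbols [B_v], sinks included, lets a linear form on [C_1] be tested on them
    alone. *)
Lemma bundle_chain_decomposition (R : realType) (E : digraph)
    (c : chain1 R E) :
  c = \sum_v (c : {ffun vertex E -> R^o}) v *: bundle_chain R v.
Proof.
apply/ffunP => u; rewrite sum_ffunE (bigD1 u) //= !ffunE eqxx.
rewrite big1 => [|w /negbTE nwu]; first by rewrite addr0 /GRing.scale /= mulr1.
by rewrite !ffunE eq_sym nwu scaler0.
Qed.

Lemma cochain1_eq0P (R : realType) (E : digraph)
    (f : 'Hom(chain1 R E, R^o)) :
  f = 0 <-> forall v, f (bundle_chain R v) = 0.
Proof.
split=> [-> v|f0]; first by rewrite lfunE.
apply/lfunP => c; rewrite lfunE (bundle_chain_decomposition _ _ c) linear_sum.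
by rewrite big1 // => v _; rewrite linearZ /= f0 scaler0.
Qed.

Theorem lemma2p5 (R : realType) (E : digraph) (lam : R) (g : cochain0 R E) :
  g \in Z0 E lam <-> special_weight lam (vertex_values g).
Proof.
rewrite /Z0 memv_ker; split=> [/eqP/cochain1_eq0P dg0 v /negbTE nsv|wg].
  have := dg0 v; rewrite coboundary_bundle nsv => /eqP.
  by rewrite subr_eq0 => /eqP.
(* At a sink the value is already 0, matching the absence of a weight equation there. *)
apply/eqP/cochain1_eq0P => v; rewrite coboundary_bundle; case: ifPn => // nsv.
by rewrite -(wg v nsv) subrr.
Qed.
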